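(* Let $\Phi=(\varphi_n)_{n\in\mathbb N}$ be a frame for a separable Hilbert space $\mathcal H$ with Bessel bound $M_\Phi$, and let $\mathcal D\in B(\mathcal H)$ be such that $\|S_\Phi^{-1/2}-\mathcal D\|<\frac{1}{\sqrt{M_\Phi}}$. Then, for an arbitrary element $\Theta$ of $\mathrm{ran}_{B(\mathcal H,\ell^2)}(T_\Phi)$, the sequence $$\Phi^{ad}=\bigl(\mathcal D^*S_\Phi^{-1/2}\varphi_n+\Theta^*(\delta_n)\bigr)_{n\in\mathbb N}$$ is an approximately dual frame of $\Phi$ for which $T_\Phi U_{\Phi^{ad}}=S_\Phi^{1/2}\mathcal D$.
   Context: $\mathcal H$ is a separable Hilbert space, $Id_{\mathcal H}$ the identity operator, $B(\mathcal H)$ (resp. $B(\mathcal H,\ell^2)$) the bounded linear operators from $\mathcal H$ to $\mathcal H$ (resp. $\ell^2$), and $(\delta_n)_n$ the canonical orthonormal basis of $\ell^2$. A sequence $\Phi=(\varphi_n)_{n\in\mathbb N}$ in $\mathcal H$ is a frame if there are constants $m_\Phi,M_\Phi>0$ with $m_\Phi\|f\|^2\le\sum_{n}|\langle f,\varphi_n\rangle|^2\le M_\Phi\|f\|^2$ for all $f\in\mathcal H$; it is a Bessel sequence with Bessel bound $M_\Phi$ if the second inequality holds. For a Bessel sequence $\Phi$: the analysis operator is $U_\Phi:\mathcal H\to\ell^2$, $U_\Phi f=(\langle f,\varphi_n\rangle)_n$; the synthesis operator is $T_\Phi:\ell^2\to\mathcal H$, $T_\Phi((c_n)_n)=\sum_n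 c_n\varphi_n$; the frame operator is $S_\Phi=T_\Phi U_\Phi$. For a frame $\Phi$, $S_\Phi$ is bounded, positive and invertible; $S_\Phi^{1/2}$ is its positive square root and $S_\Phi^{-1/2}=(S_\Phi^{1/2})^{-1}$. Two Bessel sequences $\Phi,\Phi^{ad}$ are approximately dual frames if $\|Id_{\mathcal H}-T_\Phi U_{\Phi^{ad}}\|<1$ or $\|Id_{\mathcal H}-T_{\Phi^{ad}} U_\Phi\|<1$ (equivalent conditions, by taking adjoints). Set $\mathrm{ran}_{B(\mathcal H,\ell^2)}(T_\Phi):=\{\Theta\in B(\mathcal H,\ell^2): T_\Phi\Theta=0\}$. *)

(* Defs.v *)
From HB Require Import structures.
From mathcomp Require Import all_boot all_order all_algebra.
From mathcomp Require Import all_classical all_reals all_analysis.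
From mathcomp Require Import complex sesquilinear ring lra.

Set Implicit Arguments.
Unset Strict Implicit.
Unset Printing Implicit Defensive.

Import Order.TTheory GRing.Theory Num.Theory.
Import numFieldNormedType.Exports.

Local Open Scope classical_set_scope.
Local Open Scope ring_scope.

(* Hilbert spaces are taken over the reals or over the complex numbers;
   everything below is parametrized by this choice. *)
Inductive scalar_kind := RealScalars | ComplexScalars.

Definition scalars (R : realType) (k : scalar_kind) : numFieldType :=
  match k with RealScalars => R | ComplexScalars => R[i] end.

Definition conj_scalar (R : realType) (k : scalar_kind) :
    scalars R k -> scalars R k :=
  match k with RealScalars => id | ComplexScalars => @conjc R end.

Definition re_scalar (R : realType) (k : scalar_kind) : scalars R k -> R :=
  match k with RealScalars => id | ComplexScalars => @complex.Re R end.

Definition of_real (R : realType) (k : scalar_kind) : R -> scalars R k :=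
  match k with RealScalars => id | ComplexScalars => real_complex R end.
Arguments of_real {R k}.

Section ScalarTheory.
Variables (R : realType) (k : scalar_kind).
Local Notation K := (scalars R k).
Implicit Types x y : K.

Let conj_is_zmod : zmod_morphism (@conj_scalar R k).
Proof. by case: k => // x y; exact: raddfB. Qed.

Let conj_is_monoid : monoid_morphism (@conj_scalar R k).
Proof. by case: k => //; split; [exact: rmorph1|exact: rmorphM]. Qed.

HB.instance Definition _ :=
  GRing.isZmodMorphism.Build K K (@conj_scalar R k) conj_is_zmod.
HB.instance Definition _ :=
  GRing.isMonoidMorphism.Build K K (@conj_scalar R k) conj_is_monoid.

Let of_real_is_zmod : zmod_morphism (@of_real R k).
Proof. by case: k => // x y; exact: raddfB. Qed.

Let of_real_is_monoid : monoid_morphism (@of_real R k).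
Proof. by case: k => //; split; [exact: rmorph1|exact: rmorphM]. Qed.

HB.instance Definition _ :=
  GRing.isZmodMorphism.Build R K (@of_real R k) of_real_is_zmod.
HB.instance Definition _ :=
  GRing.isMonoidMorphism.Build R K (@of_real R k) of_real_is_monoid.

Let re_is_zmod : zmod_morphism (@re_scalar R k).
Proof. by case: k => // -[a b] [c d]. Qed.

HB.instance Definition _ :=
  GRing.isZmodMorphism.Build K R (@re_scalar R k) re_is_zmod.

Lemma conj_scalarK : involutive (@conj_scalar R k).
Proof. by case: k => //; exact: conjcK. Qed.

Lemma mul_conj_scalar x : x * conj_scalar x = `|x| ^+ 2.
Proof.
by case: k x => [x|x] /=; [rewrite real_normK ?num_real // expr2|rewrite sqr_normc].
Qed.

Lemma of_realK : cancel (@of_real R k) (@re_scalar R k).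
Proof. by case: k. Qed.

Lemma ler_of_real (a b : R) : (of_real a <= of_real b :> K) = (a <= b).
Proof. by case: k => //=; rewrite lecR. Qed.

Lemma ltr_of_real (a b : R) : (of_real a < of_real b :> K) = (a < b).
Proof. by case: k => //=; rewrite ltcR. Qed.

Lemma re_ge0K x : 0 <= x -> of_real (re_scalar x) = x.
Proof. by case: k x => // x x0; apply: RRe_real; exact: ger0_real. Qed.

Lemma conj_ge0 x : 0 <= x -> conj_scalar x = x.
Proof. by move=> /re_ge0K <-; case: k x => // x; exact: conjc_real. Qed.

Lemma norm_conj_scalar x : `|conj_scalar x| = `|x|.
Proof. by case: k x => //= -[a b]; rewrite !normc_def /= sqrrN. Qed.

Lemma add_conj_scalar x : x + conj_scalar x = of_real (re_scalar x *+ 2).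
Proof.
by case: k x => //= x; rewrite addcJ raddfMn/= mulr_natl.
Qed.

Lemma norm_of_real (a : R) : `|of_real a : K| = of_real `|a|.
Proof. by case: k => //=; rewrite normc_def/= expr0n addr0 sqrtr_sqr. Qed.

Lemma normr_re_le x : `|re_scalar x| <= re_scalar `|x|.
Proof.
case: k x => /= [x|[a b]] //=.
by rewrite -sqrtr_sqr ler_wsqrtr // lerDl sqr_ge0.
Qed.

Lemma re_le_norm x : re_scalar x <= re_scalar `|x|.
Proof. exact: le_trans (ler_norm _) (normr_re_le x). Qed.

Let im_scalar : K -> R :=
  match k with RealScalars => fun=> 0 | ComplexScalars => @complex.Im R end.

Let im_unit : K := match k with RealScalars => 0 | ComplexScalars => 'i%C end.

Let scalarE x : x = of_real (re_scalar x) + im_unit * of_real (im_scalar x).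
Proof.
rewrite /im_scalar /im_unit.
by case: k x => /= x; [rewrite mul0r addr0|rewrite -complexE].
Qed.

Let normr_im_le x : `|im_scalar x| <= re_scalar `|x|.
Proof.
rewrite /im_scalar; case: k x => /= [x|[a b]] /=; first by rewrite normr0.
by rewrite -sqrtr_sqr ler_wsqrtr // lerDr sqr_ge0.
Qed.

Lemma re_norm_ge0 x : 0 <= re_scalar `|x|.
Proof. by rewrite -ler_of_real rmorph0 re_ge0K. Qed.

Lemma of_real_inj : injective (@of_real R k).
Proof. exact: (can_inj of_realK). Qed.

Lemma re_normM x y :
  re_scalar `|x * y| = re_scalar `|x| * re_scalar `|y|.
Proof. by apply: of_real_inj; rewrite rmorphM /= !re_ge0K ?normrM. Qed.

Lemma re_normD x y :
  re_scalar `|x + y| <= re_scalar `|x| + re_scalar `|y|.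
Proof. by rewrite -ler_of_real rmorphD /= !re_ge0K ?ler_normD. Qed.

Lemma of_real_cvg (u : nat -> R) (l : R) :
  u @ \oo --> l -> (fun n => of_real (u n) : K) @ \oo --> (of_real l : K).
Proof.
move=> ul; apply/cvgrPdist_lt => e e0.
have e0' : 0 < re_scalar e by rewrite -ltr_of_real rmorph0 re_ge0K ?ltW.
move/cvgrPdist_lt : ul => /(_ _ e0'); apply: filterS => n.
by rewrite -rmorphB norm_of_real -ltr_of_real re_ge0K ?ltW.
Qed.

Lemma conj_scalar_cvg (u : nat -> K) (l : K) :
  u @ \oo --> l -> (fun n => conj_scalar (u n)) @ \oo --> conj_scalar l.
Proof.
move=> ul; apply/cvgrPdist_lt => e e0.
move/cvgrPdist_lt : ul => /(_ _ e0); apply: filterS => n.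
by rewrite -rmorphB norm_conj_scalar.
Qed.

Lemma nneseries_lt_pinfty_cvg (u : nat -> R) : (forall n, 0 <= u n) ->
  (\sum_(0 <= n <oo) (u n)%:E < +oo)%E -> cvgn (series u).
Proof.
move=> u0 su; have s0 : (0 <= \sum_(0 <= n <oo) (u n)%:E)%E.
  by apply: nneseries_ge0 => n _ _; rewrite lee_fin.
apply: nondecreasing_is_cvgn.
  by apply: nondecreasing_series => n _ _; exact: u0.
exists (fine (\sum_(0 <= n <oo) (u n)%:E)%E) => _ [n _ <-].
rewrite -lee_fin fineK ?ge0_fin_numE // /series /= -sumEFin.
by apply: nneseries_lim_ge => i _ _; rewrite lee_fin.
Qed.

Lemma scalar_normed_cvg (u : nat -> K) :
  (\sum_(0 <= n <oo) (re_scalar `|u n|)%:E < +oo)%E -> cvgn (series u).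
Proof.
move=> su; have real_case (v : nat -> R) :
    (forall n, `|v n| <= re_scalar `|u n|) -> cvgn (series v).
  move=> vu; apply: normed_cvg; apply: nneseries_lt_pinfty_cvg => [n/=|/=].
    exact: normr_ge0.
  by apply: le_lt_trans su; apply: lee_nneseries => n *; rewrite lee_fin.
have /of_real_cvg cre := real_case _ (fun n => normr_re_le (u n)).
have /of_real_cvg cim := real_case _ (fun n => normr_im_le (u n)).
rewrite (_ : series u = (fun n => of_real (series (@re_scalar R k \o u) n)) \+
    (fun n => im_unit * of_real (series (im_scalar \o u) n))).
  exact: (cvgP _ (cvgD cre (cvgMl_tmp (a := im_unit) cim))).
apply/funext => n /=; rewrite /series /= !rmorph_sum mulr_sumr -big_split /=.
by apply: eq_bigr => i _; rewrite [LHS]scalarE.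
Qed.

End ScalarTheory.

Section DotTheory.
Variables (R : realType) (k : scalar_kind).
Local Notation K := (scalars R k).
Variables (U : lmodType K) (d : {dot U for @conj_scalar R k}).
Implicit Types x y : U.

Lemma dotC x y : d x y = conj_scalar (d y x).
Proof. by rewrite (@hermC _ _ (@conj_scalar R k)) expr0 mul1r. Qed.

Lemma dot_ge0 x : 0 <= d x x.
Proof.
have [->|x0] := eqVneq x 0; first by rewrite linear0l.
by apply: ltW; exact: neq0_dnorm_gt0.
Qed.

Lemma dot_CauchySchwarz x y : `|d x y| ^+ 2 <= d x x * d y y.
Proof.
have [->|y0] := eqVneq y 0; first by rewrite !linear0r normr0 expr0n /=.
have dy0 : 0 < d y y by exact: neq0_dnorm_gt0.
have dt t : d (x - t *: y) (x - t *: y) =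
    d x x - conj_scalar t * d x y - (t * d y x - t * (conj_scalar t * d y y)).
  rewrite (linearBl d) /= 2!(linearBr d) /=.
  by rewrite 2!(linearZl_LR d) /= 2!(linearZr_LR d).
have := dot_ge0 (x - (d x y / d y y) *: y); rewrite dt.
rewrite rmorphM fmorphV /= (conj_ge0 (dot_ge0 y)) (dotC y x).
set a := d x y; set b := d y y; rewrite divfK ?gt_eqF // subrr subr0 subr_ge0.
by rewrite mulrAC (mulrC _ a) mul_conj_scalar ler_pdivrMr.
Qed.

Definition dot_norm x : K := of_real (Num.sqrt (re_scalar (d x x))).

Lemma dot_norm_ge0 x : 0 <= dot_norm x.
Proof. by rewrite -(rmorph0 (@of_real R k)) ler_of_real sqrtr_ge0. Qed.

Lemma sqr_dot_norm x : dot_norm x ^+ 2 = d x x.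
Proof.
rewrite /dot_norm -rmorphXn /= sqr_sqrtr ?re_ge0K ?dot_ge0 //.
by rewrite -(ler_of_real k) rmorph0 re_ge0K ?dot_ge0.
Qed.

Lemma dot_normZ (a : K) x : dot_norm (a *: x) = `|a| * dot_norm x.
Proof.
apply/eqP; rewrite -(@eqrXn2 _ 2) ?mulr_ge0 ?dot_norm_ge0 //.
by rewrite exprMn !sqr_dot_norm linearZl_LR linearZr_LR /= mulrA mul_conj_scalar.
Qed.

Lemma dot_norm_eq0 x : dot_norm x = 0 -> x = 0.
Proof.
move=> x0; apply: contrapT => /eqP /(@neq0_dnorm_gt0 _ _ _ d).
by rewrite -sqr_dot_norm x0 expr0n ltxx.
Qed.

Lemma ler_dot_normD x y : dot_norm (x + y) <= dot_norm x + dot_norm y.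
Proof.
rewrite -(@ler_pXn2r _ 2) ?nnegrE ?addr_ge0 ?dot_norm_ge0 //.
rewrite sqrrD !sqr_dot_norm linearDl !linearDr /= addrACA addrA.
rewrite lerD2r -addrA lerD2l addrC.
rewrite (dotC y x) add_conj_scalar -[dot_norm x * _]re_ge0K; last first.
  by rewrite mulr_ge0 ?dot_norm_ge0.
rewrite -rmorphMn ler_of_real lerMn2r /= (le_trans (re_le_norm _)) //.
rewrite -(ler_of_real k) !re_ge0K ?mulr_ge0 ?dot_norm_ge0 //.
rewrite -(@ler_pXn2r _ 2) ?nnegrE ?mulr_ge0 ?dot_norm_ge0 //.
by rewrite exprMn !sqr_dot_norm dot_CauchySchwarz.
Qed.

End DotTheory.

HB.mixin Record NormedModule_isInnerProduct (R : realType) (k : scalar_kind) H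
    & NormedModule (scalars R k) H := {
  dot : {dot H for @conj_scalar R k} ;
  dotxx : forall x, dot x x = `|x| ^+ 2
}.

#[short(type="innerProductType")]
HB.structure Definition InnerProduct (R : realType) (k : scalar_kind) :=
  {H of NormedModule (scalars R k) H & NormedModule_isInnerProduct R k H}.

#[short(type="hilbertType")]
HB.structure Definition Hilbert (R : realType) (k : scalar_kind) :=
  {H of InnerProduct R k H & Complete H}.

(* Norms in [normedModType K] take values in [K]; [rnorm] is the same norm,
   with values in [R]. *)
Definition rnorm (R : realType) (k : scalar_kind)
  (V : normedModType (scalars R k)) (x : V) : R := re_scalar `|x|.

Section Ell2.
Variables (R : realType) (k : scalar_kind).
Local Notation K := (scalars R k).

Definition square_summable : {pred nat -> K} :=
  fun c => (\sum_(0 <= n <oo) (re_scalar `|c n| ^+ 2)%:E < +oo :> \bar R)%E.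

Lemma square_summable_closed : submod_closed square_summable.
Proof.
split=> [|a c d]; rewrite !unfold_in.
  by rewrite eseries0 // => n _ _ /=; rewrite normr0 raddf0 expr0n.
move=> cs ds; set A := 2 * re_scalar `|a| ^+ 2.
have A0 : 0 <= A by rewrite mulr_ge0 // sqr_ge0.
apply: (@le_lt_trans _ _ (\sum_(0 <= n <oo)
    (A%:E * (re_scalar `|c n| ^+ 2)%:E + 2%:E * (re_scalar `|d n| ^+ 2)%:E))%E).
  apply: lee_nneseries => n *; first by rewrite lee_fin sqr_ge0.
  rewrite -!EFinM -EFinD lee_fin /A -mulrA -exprMn -re_normM -mulrDr.
  have := re_normD (a * c n) (d n).
  have := sqr_ge0 (re_scalar `|a * c n| - re_scalar `|d n|).
  have := re_norm_ge0 (a * c n + d n).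
  rewrite -[((a *: c) + d) n]/(a * c n + d n).
  by move: (re_scalar _) (re_scalar _) (re_scalar _) => x y z; nra.
rewrite nneseriesD; [|by move=> *; rewrite mule_ge0 ?lee_fin ?sqr_ge0..].
rewrite !nneseriesZl; [|by move=> *; rewrite lee_fin sqr_ge0..].
by rewrite lte_add_pinfty // lte_mul_pinfty // lee_fin.
Qed.

HB.instance Definition _ :=
  GRing.isSubmodClosed.Build K (nat -> K) square_summable square_summable_closed.

Record ell2 :=
  Ell2 { ell2_val :> nat -> K ; ell2P : ell2_val \in square_summable }.

HB.instance Definition _ := [isSub for ell2_val].
HB.instance Definition _ := [Choice of ell2 by <:].
HB.instance Definition _ := [SubChoice_isSubLmodule of ell2 by <:].

Definition ell2_dot (c d : ell2) : K :=
  limn (series (fun n => c n * conj_scalar (d n))).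

Lemma is_cvg_ell2_dot (c d : ell2) :
  cvgn (series (fun n => c n * conj_scalar (d n))).
Proof.
apply: scalar_normed_cvg; have := ell2P c; have := ell2P d.
rewrite !unfold_in => ds cs.
apply: (@le_lt_trans _ _ (\sum_(0 <= n <oo)
    ((re_scalar `|c n| ^+ 2)%:E + (re_scalar `|d n| ^+ 2)%:E))%E).
  apply: lee_nneseries => n *; first by rewrite lee_fin re_norm_ge0.
  rewrite -EFinD lee_fin re_normM norm_conj_scalar.
  have := sqr_ge0 (re_scalar `|c n| - re_scalar `|d n|).
  have := re_norm_ge0 (c n); have := re_norm_ge0 (d n).
  by move: (re_scalar _) (re_scalar _) => x y; nra.
by rewrite nneseriesD ?lte_add_pinfty // => *; rewrite lee_fin sqr_ge0.
Qed.

Let ell2_dotC (c d : ell2) : ell2_dot c d = (-1) ^+ false * conj_scalar (ell2_dot d c).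
Proof.
rewrite expr0 mul1r; apply/cvg_lim => //.
rewrite (_ : series _ = (fun n =>
    conj_scalar (series (fun i => d i * conj_scalar (c i)) n))).
  exact: conj_scalar_cvg (@is_cvg_ell2_dot d c).
apply/funext => n; rewrite rmorph_sum; apply: eq_bigr => i _.
by rewrite rmorphM /= conj_scalarK mulrC.
Qed.

Let ell2_dotPl (d : ell2) (a : K) (c c' : ell2) :
  ell2_dot (a *: c + c') d = a * ell2_dot c d + ell2_dot c' d.
Proof.
apply/cvg_lim => //.
rewrite (_ : series _ = (fun n =>
    a * series (fun i => c i * conj_scalar (d i)) n) \+
    series (fun i => c' i * conj_scalar (d i))).
  exact: (cvgD (cvgMl_tmp (a := a) (@is_cvg_ell2_dot c d)) (@is_cvg_ell2_dot c' d)).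
apply/funext => n; rewrite /series /= mulr_sumr -big_split /=.
by apply: eq_bigr => i _; rewrite mulrDl mulrA.
Qed.

Let ell2_dotPr (c : ell2) (a : K) (d d' : ell2) :
  ell2_dot c (a *: d + d') = conj_scalar a * ell2_dot c d + ell2_dot c d'.
Proof.
by rewrite ell2_dotC ell2_dotPl expr0 mul1r rmorphD rmorphM /=
  !(ell2_dotC c) !expr0 !mul1r.
Qed.

Let ell2_dot_gt0 (c : ell2) : c != 0 -> 0 < ell2_dot c c.
Proof.
move=> c0; have [m cm0] : exists m, c m != 0.
  apply: contrapT => /forallNP c0'; move/eqP: c0; apply; apply: val_inj.
  by apply/funext => m; apply: contrapT => /eqP cm; exact: (c0' m).
pose u n := re_scalar `|c n| ^+ 2.
have u0 n : 0 <= u n by exact: sqr_ge0.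
have cu : cvgn (series u) by apply: nneseries_lt_pinfty_cvg => //; exact: ell2P c.
rewrite (_ : ell2_dot c c = of_real (limn (series u))).
  rewrite -(rmorph0 (@of_real R k)) ltr_of_real.
  apply: (@lt_le_trans _ _ (series u m.+1)); last first.
    apply: (nondecreasing_cvgn_le _ cu).
    by apply: nondecreasing_series => n _ _; exact: u0.
  rewrite seriesSr ltr_wpDl ?sumr_ge0 // exprn_gt0 //.
  by rewrite -(ltr_of_real k) rmorph0 re_ge0K // normr_gt0.
apply/cvg_lim => //; rewrite (_ : series _ = (fun n => of_real (series u n))).
  exact: of_real_cvg.
apply/funext => n; rewrite rmorph_sum; apply: eq_bigr => i _.
by rewrite rmorphXn /= re_ge0K // mul_conj_scalar.
Qed.

Let ell2_dot_bilinear : bilinear_for *%R (@conj_scalar R k \; *%R) ell2_dot.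
Proof. by split=> [d a c c'|c a d d']; [exact: ell2_dotPl|exact: ell2_dotPr]. Qed.

HB.instance Definition _ := bilinear_isBilinear.Build K ell2 ell2 K
  ( *%R ) (@conj_scalar R k \; *%R) ell2_dot ell2_dot_bilinear.
HB.instance Definition _ :=
  isHermitianSesquilinear.Build K ell2 false (@conj_scalar R k) ell2_dot ell2_dotC.
HB.instance Definition _ := isDotProduct.Build K ell2 ell2_dot ell2_dot_gt0.

HB.instance Definition _ := Lmodule_isNormed.Build K ell2
  (ler_dot_normD ell2_dot) (dot_normZ ell2_dot) (dot_norm_eq0 (d := ell2_dot)).

HB.instance Definition _ := NormedModule_isInnerProduct.Build R k ell2
  (fun c : ell2 => esym (sqr_dot_norm ell2_dot c)).

Lemma delta_subproof (n : nat) :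
  (fun m => (m == n)%:R : K) \in square_summable.
Proof.
rewrite unfold_in (nneseries_split 0 n.+1); last first.
  by move=> m _; rewrite lee_fin sqr_ge0.
rewrite [X in (_ + X)%E]eseries0 ?adde0.
  by rewrite sumEFin ltry.
by move=> m; rewrite add0n => nm _; rewrite gtn_eqF // normr0 raddf0 expr0n.
Qed.

Definition delta (n : nat) : ell2 := Ell2 (delta_subproof n).

End Ell2.
Arguments delta {R k}.

Section Operators.
Variables (R : realType) (k : scalar_kind).
Local Notation K := (scalars R k).

Definition separable (T : topologicalType) : Prop :=
  exists2 A : set T, countable A & dense A.

Definition bounded_op (U V : normedModType K) (A : U -> V) : Prop :=
  exists C : R, forall x, rnorm (A x) <= C * rnorm x.

(* The supremum is taken in the extended reals, so that an unbounded map has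
   norm +oo instead of the default value of [sup]. *)
Definition opnorm (U V : normedModType K) (A : U -> V) : \bar R :=
  ereal_sup [set (rnorm (A x))%:E | x in [set x : U | rnorm x <= 1]].

(* [adjoint], [inv_op] and [sqrt_op] select the map satisfying the defining
   property; it is unique when it exists, and the default value is the zero
   map. *)
Definition adjoint (U V : innerProductType R k) (A : U -> V) : V -> U :=
  xget (cst 0) [set B : V -> U | forall u v, dot (A u) v = dot u (B v)].

Definition inv_op (U : lmodType K) (A : U -> U) : U -> U :=
  xget (cst 0) [set B : U -> U | cancel A B /\ cancel B A].

(* Self-adjointness is part of the definition: it follows from the second
   condition over the complex numbers, but not over the reals. *)
Definition positive_op (U : innerProductType R k) (A : U -> U) : Prop :=
  (forall u v, dot (A u) v = dot u (A v)) /\ (forall u, 0 <= dot (A u) u).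

Definition sqrt_op (U : innerProductType R k) (S : U -> U) : U -> U :=
  xget (cst 0) [set B : U -> U |
    [/\ linear B, bounded_op B, positive_op B & B \o B = S]].

End Operators.

Section Frames.
Variables (R : realType) (k : scalar_kind) (H : hilbertType R k).
Implicit Types (Phi Psi : nat -> H).

Definition coef_sum Phi (f : H) : \bar R :=
  (\sum_(0 <= n <oo) (re_scalar `|dot f (Phi n)| ^+ 2)%:E)%E.

Definition bessel_bound Phi (M : R) : Prop :=
  0 < M /\ forall f : H, (coef_sum Phi f <= (M * rnorm f ^+ 2)%:E)%E.

Definition lower_frame_bound Phi (m : R) : Prop :=
  0 < m /\ forall f : H, ((m * rnorm f ^+ 2)%:E <= coef_sum Phi f)%E.

Definition bessel Phi : Prop := exists M, bessel_bound Phi M.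

Definition frame Phi : Prop :=
  exists m M, lower_frame_bound Phi m /\ bessel_bound Phi M.

(* The coefficient sequence is square-summable as soon as [Phi] is a Bessel
   sequence; otherwise the default value is 0. *)
Definition analysis Phi (f : H) : ell2 R k :=
  insubd 0 (fun n => dot f (Phi n)).

Definition synthesis Phi (c : ell2 R k) : H :=
  limn (series (fun n => c n *: Phi n)).

Definition frame_op Phi : H -> H := synthesis Phi \o analysis Phi.

Definition frame_sqrt Phi : H -> H := sqrt_op (frame_op Phi).

Definition frame_inv_sqrt Phi : H -> H := inv_op (frame_sqrt Phi).

Definition approximately_dual Phi Psi : Prop :=
  [/\ bessel Phi, bessel Psi &
      (opnorm (idfun \- (synthesis Phi \o analysis Psi))%R < 1)%E \/
      (opnorm (idfun \- (synthesis Psi \o analysis Phi))%R < 1)%E].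

Definition ran_synthesis Phi : set {linear H -> ell2 R k} :=
  [set Theta | bounded_op Theta /\ forall f, synthesis Phi (Theta f) = 0].

End Frames.

(* Main.v *)
(* A coercive symmetric operator S has a contraction A = Id - t S for a suitable
   t > 0.  The iteration Y_(n+1) = (A + Y_n Y_n) / 2 then converges strongly, at a
   geometric rate, to some Y with 2 Y = A + Y^2, so (Id - Y)^2 = t S: this yields
   the square root of the frame operator S without spectral theory, and Neumann
   iteration with A yields its invertibility.  Adjoints come from the Riesz
   representation theorem.  With B = S^(1/2), moving D, B^(-1) and Theta across
   the inner product gives U_ad = U B^(-1) D + Theta, hence T U_ad = S B^(-1) D =
   B D.  Since |B f| = |U f| <= sqrt M |f|, the operator Id - B D = B (B^(-1) - D)
   has norm less than 1. *)
Require Import Defs.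
From HB Require Import structures.
From mathcomp Require Import all_boot all_order all_algebra.
From mathcomp Require Import all_classical all_reals all_analysis.
From mathcomp Require Import sesquilinear ring lra.

Import Order.TTheory GRing.Theory Num.Theory.
Import numFieldNormedType.Exports.

Local Open Scope classical_set_scope.
Local Open Scope ring_scope.

(** * Real-valued norms, convergence and completeness *)

Section RealNorm.
Set Implicit Arguments.
Unset Strict Implicit.
Variables (R : realType) (k : scalar_kind).
Local Notation K := (scalars R k).

Section NormedModule.
Variable V : normedModType K.
Implicit Types (x y : V) (u : nat -> V).

Lemma rnormK x : of_real (rnorm x) = `|x| :> K.
Proof. exact: re_ge0K. Qed.

Lemma rnorm_ge0 x : 0 <= rnorm x.
Proof. by rewrite -(ler_of_real k) rmorph0 rnormK. Qed.

Lemma rnorm0 : rnorm (0 : V) = 0.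
Proof. by rewrite /rnorm normr0 raddf0. Qed.

Lemma rnorm_eq0 x : rnorm x = 0 -> x = 0.
Proof. by move=> x0; apply/normr0_eq0; rewrite -rnormK x0 rmorph0. Qed.

Lemma rnormD x y : rnorm (x + y) <= rnorm x + rnorm y.
Proof. by rewrite -(ler_of_real k) rmorphD /= !rnormK ler_normD. Qed.

Lemma rnormN x : rnorm (- x) = rnorm x.
Proof. by rewrite /rnorm normrN. Qed.

Lemma rnormB x y : rnorm (x - y) = rnorm (y - x).
Proof. by rewrite /rnorm distrC. Qed.

Lemma rnorm_distD y x z : rnorm (x - z) <= rnorm (x - y) + rnorm (y - z).
Proof. by rewrite -[x - z](subrKA y) rnormD. Qed.

Lemma rnormZ (a : K) x : rnorm (a *: x) = re_scalar `|a| * rnorm x.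
Proof. by apply: (@of_real_inj R k); rewrite rmorphM /= !rnormK normrZ re_ge0K. Qed.

Lemma rnormZr (a : R) x : rnorm ((of_real a : K) *: x) = `|a| * rnorm x.
Proof. by rewrite rnormZ norm_of_real of_realK. Qed.

Lemma rnorm_cvgP u (l : V) :
  u @ \oo --> l <-> forall e : R, 0 < e -> \forall n \near \oo, rnorm (u n - l) < e.
Proof.
split=> [ul e e0|ul].
  have e0' : 0 < (of_real e : K) by rewrite -(rmorph0 (@of_real R k)) ltr_of_real.
  move/cvgrPdistC_lt : ul => /(_ _ e0'); apply: filterS => n.
  by rewrite -rnormK ltr_of_real.
apply/cvgrPdistC_lt => e e0.
have e0' : 0 < re_scalar e by rewrite -(ltr_of_real k) rmorph0 re_ge0K ?ltW.
have := ul _ e0'; apply: filterS => n.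
by rewrite -(ltr_of_real k) rnormK re_ge0K ?ltW.
Qed.

Lemma rnorm_squeeze u (l : V) (r : nat -> R) :
  (forall n, rnorm (u n - l) <= r n) -> r @ \oo --> 0 -> u @ \oo --> l.
Proof.
move=> ur r0; apply/rnorm_cvgP => e e0.
move/cvgr0Pnorm_lt : r0 => /(_ _ e0); apply: filterS => n.
by apply: le_lt_trans; rewrite (le_trans (ur n)) ?ler_norm.
Qed.

Lemma rnorm_cvg_le u (l : V) (c : R) :
  u @ \oo --> l -> (forall n, rnorm (u n) <= c) -> rnorm l <= c.
Proof.
move=> /rnorm_cvgP ul uc; apply/ler_addgt0Pr => e e0.
have [n lt] := filter_ex (ul e e0).
by rewrite -[l](subrKC (u n)) (le_trans (rnormD _ _)) // lerD // rnormB ltW.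
Qed.

Lemma rnorm_cvg0P u (l : V) :
  u @ \oo --> l <-> (fun n => rnorm (u n - l)) @ \oo --> (0 : R).
Proof.
split=> [/rnorm_cvgP ul|]; last exact: rnorm_squeeze.
apply/cvgr0Pnorm_lt => e e0; have := ul e e0; apply: filterS => n.
by rewrite ger0_norm ?rnorm_ge0.
Qed.

Lemma seq_cvg_unique u (l l' : V) : u @ \oo --> l -> u @ \oo --> l' -> l = l'.
Proof. by move=> /(norm_cvg_lim (V := V)) <- /(norm_cvg_lim (V := V)) <-. Qed.

End NormedModule.

Lemma bounded_cvg (U V : normedModType K) (A : {linear U -> V}) (u : nat -> U) (l : U) :
  bounded_op A -> u @ \oo --> l -> A \o u @ \oo --> A l.
Proof.
move=> [C AC] /rnorm_cvg0P ul; apply: (rnorm_squeeze (r := fun n => C * rnorm (u n - l))).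
  by move=> n /=; rewrite -linearB.
by rewrite -[0](mulr0 C); apply: cvgMl_tmp.
Qed.

Section Complete.
Variable V : hilbertType R k.

Lemma rnorm_cauchy_cvg (u : nat -> V) (r : nat -> R) :
  (forall n m, (n <= m)%N -> rnorm (u m - u n) <= r n) -> r @ \oo --> 0 -> cvgn u.
Proof.
move=> ur r0; apply: cauchy_cvg; apply/cauchy_exP => e e0.
have e0' : 0 < re_scalar e by rewrite -(ltr_of_real k) rmorph0 re_ge0K ?ltW.
move/cvgr0Pnorm_lt : r0 => /(_ _ e0') [N _ rN].
exists (u N); exists N => // n /= Nn; rewrite -ball_normE /=.
rewrite -rnormK -[e]re_ge0K ?ltW // ltr_of_real rnormB.
by apply: le_lt_trans (rN N _) => //=; rewrite (le_trans (ur _ _ Nn)) ?ler_norm.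
Qed.

Lemma geometric_cvg (u : nat -> V) (c q : R) : 0 <= q < 1 ->
  (forall n, rnorm (u n.+1 - u n) <= c * q ^+ n) ->
  exists2 l, u @ \oo --> l & forall n, rnorm (u n - l) <= c / (1 - q) * q ^+ n.
Proof.
move=> /andP[q0 q1] uq.
have c0 : 0 <= c by have := uq 0%N; rewrite mulr1; apply: le_trans; exact: rnorm_ge0.
have q1' : 0 < 1 - q by rewrite subr_gt0.
(* The factor [1 - q ^+ m] comes from the exact finite geometric sum, so the induction on [m] closes
   with an equality. *)
have tail n m : rnorm (u (n + m)%N - u n) <= c / (1 - q) * q ^+ n * (1 - q ^+ m).
  elim: m => [|m IH]; first by rewrite addn0 subrr rnorm0 expr0 subrr mulr0.
  rewrite addnS (le_trans (rnorm_distD (u (n + m)%N) _ _)) //.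
  apply: le_trans (lerD (uq _) IH) _; rewrite le_eqVlt; apply/orP; left; apply/eqP.
  by rewrite exprD exprS; field; rewrite gt_eqF.
have tail' n m : (n <= m)%N -> rnorm (u m - u n) <= c / (1 - q) * q ^+ n.
  move=> /subnKC <-; rewrite (le_trans (tail _ _)) // ler_piMr //.
    by rewrite mulr_ge0 ?exprn_ge0 // divr_ge0 // ltW.
  by rewrite gerBl exprn_ge0.
have lim0 : (fun n => c / (1 - q) * q ^+ n) @ \oo --> 0.
  by apply: cvg_geometric; rewrite ger0_norm.
have cu := rnorm_cauchy_cvg tail' lim0.
exists (limn u) => // n; rewrite rnormB.
have sh : (fun m => u (m + n)%N - u n) @ \oo --> limn u - u n.
  by apply: cvgB; [rewrite cvg_shiftn|exact: cvg_cst].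
by apply: (rnorm_cvg_le sh) => m; rewrite tail' ?leq_addl.
Qed.

End Complete.
End RealNorm.

(** * The real part of the inner product, and continuity of the inner product *)

Section InnerProduct.
Set Implicit Arguments.
Unset Strict Implicit.
Variables (R : realType) (k : scalar_kind).
Local Notation K := (scalars R k).
Variable V : innerProductType R k.
Implicit Types (x y z : V).

(** The underlying real inner product: quadratic estimates become polynomial inequalities over the
    ordered field [R], for both kinds of scalars at once. *)
Definition rdot x y : R := re_scalar (dot x y).

Lemma rdotxx x : rdot x x = rnorm x ^+ 2.
Proof. by apply: (@of_real_inj R k); rewrite rmorphXn /= rnormK -dotxx re_ge0K ?dot_ge0. Qed.

Lemma rdotC x y : rdot x y = rdot y x.
Proof. by rewrite /rdot dotC; case: (k) (dot y x) => // -[]. Qed.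

Lemma rdotDl x y z : rdot (x + y) z = rdot x z + rdot y z.
Proof. by rewrite /rdot linearDl raddfD. Qed.

Lemma rdotBl x y z : rdot (x - y) z = rdot x z - rdot y z.
Proof. by rewrite /rdot linearBl raddfB. Qed.

Lemma re_scalarZ (a : R) (b : K) : re_scalar (of_real a * b) = a * re_scalar b.
Proof. by case: (k) b => //= -[b c] /=; rewrite mul0r subr0. Qed.

Lemma conj_of_real (a : R) : conj_scalar (of_real a : K) = of_real a.
Proof. by case: (k) => //=; rewrite oppr0. Qed.

Lemma rdotZl (a : R) x y : rdot ((of_real a : K) *: x) y = a * rdot x y.
Proof. by rewrite /rdot linearZl_LR /= re_scalarZ. Qed.

Lemma rdotDr x y z : rdot x (y + z) = rdot x y + rdot x z.
Proof. by rewrite !(rdotC x) rdotDl. Qed.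

Lemma rdotBr x y z : rdot x (y - z) = rdot x y - rdot x z.
Proof. by rewrite !(rdotC x) rdotBl. Qed.

Lemma rdotZr (a : R) x y : rdot x ((of_real a : K) *: y) = a * rdot x y.
Proof. by rewrite !(rdotC x) rdotZl. Qed.

Lemma norm_dot_le x y : re_scalar `|dot x y| <= rnorm x * rnorm y.
Proof.
rewrite -(@ler_pXn2r _ 2) ?nnegrE ?re_norm_ge0 ?mulr_ge0 ?rnorm_ge0 //.
rewrite -(ler_of_real k) !rmorphXn rmorphM /= exprMn !rnormK.
by rewrite -!dotxx dot_CauchySchwarz.
Qed.

Lemma rdot_le x y : `|rdot x y| <= rnorm x * rnorm y.
Proof. exact: le_trans (normr_re_le _) (norm_dot_le x y). Qed.

Lemma rnormD_sqr x y : rnorm (x + y) ^+ 2 = rnorm x ^+ 2 + 2 * rdot x y + rnorm y ^+ 2.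
Proof. by rewrite -!rdotxx rdotDl !rdotDr (rdotC y x); ring. Qed.

Lemma rnormB_sqr x y : rnorm (x - y) ^+ 2 = rnorm x ^+ 2 - 2 * rdot x y + rnorm y ^+ 2.
Proof. by rewrite -!rdotxx rdotBl !rdotBr (rdotC y x); ring. Qed.

Lemma scalar_cvg (u : nat -> K) (l : K) (r : nat -> R) :
  (forall n, re_scalar `|u n - l| <= r n) -> r @ \oo --> 0 -> u @ \oo --> l.
Proof. exact: (@rnorm_squeeze R k K). Qed.

Lemma dot_cvgl (u : nat -> V) (l y : V) :
  u @ \oo --> l -> (fun n => dot (u n) y) @ \oo --> dot l y.
Proof.
move=> /rnorm_cvg0P ul; apply: (scalar_cvg (r := fun n => rnorm (u n - l) * rnorm y)).
  by move=> n; rewrite -linearBl norm_dot_le.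
by rewrite -[0](mul0r (rnorm y)); apply: cvgMr_tmp.
Qed.

Lemma dot_cvgr (u : nat -> V) (l y : V) :
  u @ \oo --> l -> (fun n => dot y (u n)) @ \oo --> dot y l.
Proof.
move=> ul; rewrite dotC; under eq_fun do rewrite dotC.
exact/conj_scalar_cvg/dot_cvgl.
Qed.

End InnerProduct.

(** * The Riesz representation theorem, by minimizing a quadratic functional *)

Lemma norm_le_cvg0_eq0 (R : realType) (a : R) (r : nat -> R) :
  (forall n, `|a| <= r n) -> r @ \oo --> 0 -> a = 0.
Proof.
move=> ar /cvgr0Pnorm_lt r0; apply: contrapT => /eqP; rewrite -normr_gt0 => a0.
have [n] := filter_ex (r0 _ a0).
by rewrite ltNge (le_trans (ar n)) // ler_norm.
Qed.

Section Riesz.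
Set Implicit Arguments.
Unset Strict Implicit.
Variables (R : realType) (k : scalar_kind) (H : hilbertType R k).
Local Notation K := (scalars R k).
Variables (l : {linear H -> K}) (C : R).
Hypothesis lC : forall x, re_scalar `|l x| <= C * rnorm x.

(* The representing vector is the minimizer of [F]. *)
Let F x := rnorm x ^+ 2 - 2 * re_scalar (l x).

(** Completing the square: the linear part is at most [C * rnorm x], and [(rnorm x - C) ^+ 2] is
    nonnegative. Hence the infimum [I] is finite. *)
Let F_ge x : - C ^+ 2 <= F x.
Proof.
rewrite /F; have := le_trans (re_le_norm _) (lC x).
have := sqr_ge0 (rnorm x - C); nra.
Qed.

Let I := inf (range F).

Let F_inf x : I <= F x.
Proof. by apply: ge_inf; [exists (- C ^+ 2) => _ [y _ <-]|exists x]. Qed.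

Let F_approx (n : nat) : {x | F x < I + n.+1%:R^-1}.
Proof.
apply: cid; have n0 : 0 < n.+1%:R^-1 :> R by rewrite invr_gt0.
have hI : has_inf (range F).
  by split; [exists (F 0); exists 0|exists (- C ^+ 2) => _ [y _ <-]; exact: F_ge].
by have [_ [x _ <-] Fx] := inf_adherent n0 hI; exists x.
Qed.

Let u n := sval (F_approx n).

Let re_lZ a x : re_scalar (l ((of_real a : K) *: x)) = a * re_scalar (l x).
Proof. by rewrite linearZ; exact: re_scalarZ. Qed.

Let re_lD x y : re_scalar (l (x + y)) = re_scalar (l x) + re_scalar (l y).
Proof. by rewrite linearD raddfD. Qed.

(* Parallelogram identity: minimizing sequences of [F] are Cauchy. *)
Let F_midpoint x y :
  rnorm (x - y) ^+ 2 = 2 * F x + 2 * F y - 4 * F ((of_real 2^-1 : K) *: (x + y)).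
Proof.
rewrite /F re_lZ re_lD rnormZr exprMn ger0_norm //.
by rewrite rnormB_sqr rnormD_sqr; field.
Qed.

(** Both values of [F] lie within [n.+1%:R^-1] of [I], while the midpoint has value at least [I]; in
    [F_midpoint] the copies of [I] cancel. *)
Let u_cauchy n m : (n <= m)%N -> rnorm (u m - u n) <= Num.sqrt (4 * n.+1%:R^-1).
Proof.
move=> nm; rewrite -[leLHS]ger0_norm ?rnorm_ge0 // -sqrtr_sqr ler_wsqrtr //.
rewrite F_midpoint; have := F_inf ((of_real 2^-1 : K) *: (u m + u n)).
have /= := svalP (F_approx n); have /= := svalP (F_approx m); rewrite -/(u n) -/(u m).
have : m.+1%:R^-1 <= n.+1%:R^-1 :> R by rewrite lef_pV2 ?posrE // ler_nat.
move: (n.+1%:R^-1) (m.+1%:R^-1) (F _) (F _) (F _) => e d a b c; lra.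
Qed.

Let harm0 : (fun n => Num.sqrt (4 * n.+1%:R^-1) : R) @ \oo --> 0.
Proof.
rewrite -[0 in X in _ --> X]sqrtr0 -(mulr0 4).
apply: cvg_comp; last exact: sqrt_continuous.
by apply: cvgMl_tmp; exact: cvg_harmonic.
Qed.

(* First-order optimality at the near-minimizer [u n], tested in the direction
   [- t *: v] for the optimal [t]. *)
Let F_deriv_approx v n :
  (rdot v (u n) - re_scalar (l v)) ^+ 2 <= n.+1%:R^-1 * rnorm v ^+ 2.
Proof.
(* The optimal [t] divides by [rnorm v ^+ 2], so the zero direction is treated apart; there both
   terms on the left vanish. *)
have [v0|v0] := eqVneq (rnorm v) 0.
  have := rdot_le v (u n); have := lC v; rewrite v0 mul0r mulr0 expr0n mulr0 /=.
  move=> /(le_trans (normr_re_le _)); rewrite !normr_le0 => /eqP -> /eqP ->.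
  by rewrite subrr expr0n.
have := F_inf (u n + (of_real (- ((rdot v (u n) - re_scalar (l v)) / rnorm v ^+ 2)) : K) *: v).
have := svalP (F_approx n); rewrite -/(u n) /F.
rewrite rnormD_sqr rdotZr rnormZr exprMn real_normK ?num_real // re_lD re_lZ (rdotC (u n)).
set a := rdot _ _; set b := re_scalar (l v); set N := rnorm v.
set t := _ / _ => F1 F2.
have v2 : 0 < N ^+ 2 by rewrite exprn_even_gt0.
have ab : a - b = t * N ^+ 2 by rewrite /t divfK ?gt_eqF.
rewrite ab exprMn expr2 mulrA ler_wpM2r ?ltW //.
have tab : t * (a - b) = t * (t * N ^+ 2) by rewrite ab.
move: (n.+1%:R^-1) (rnorm (u n)) (re_scalar (l (u n))) F1 F2 => e U L; nra.
Qed.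

Lemma riesz : exists z, forall x, l x = dot x z.
Proof.
have cu := rnorm_cauchy_cvg u_cauchy harm0.
pose z := limn u; exists z.
have uz n : rnorm (z - u n) <= Num.sqrt (4 * n.+1%:R^-1).
  have sh : (fun m => u (m + n)%N - u n) @ \oo --> z - u n.
    by apply: cvgB; [rewrite cvg_shiftn|exact: cvg_cst].
  by apply: (rnorm_cvg_le sh) => m; rewrite u_cauchy ?leq_addl.
have F_deriv v n :
    `|rdot v z - re_scalar (l v)| <= 2 * rnorm v * Num.sqrt (4 * n.+1%:R^-1).
  (* Passing through [u n] gives two errors: Cauchy-Schwarz with [uz] bounds the first,
     [F_deriv_approx] the second. *)
  rewrite -(subrKA (rdot v (u n))) (le_trans (ler_normD _ _)) //.
  rewrite -mulrA mulr_natl mulr2n lerD //.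
    by rewrite -rdotBr (le_trans (rdot_le _ _)) // ler_wpM2l ?rnorm_ge0.
  rewrite -sqrtr_sqr -[X in X * _]ger0_norm ?rnorm_ge0 // -sqrtr_sqr -sqrtrM ?sqr_ge0 //.
  apply: ler_wsqrtr; apply: le_trans (F_deriv_approx v n) _.
  have : 0 < n.+1%:R^-1 :> R by rewrite invr_gt0.
  have := sqr_ge0 (rnorm v); move: (rnorm v ^+ 2) (n.+1%:R^-1) => N e; nra.
have Fz v : rdot v z = re_scalar (l v).
  apply/eqP; rewrite -subr_eq0; apply/eqP.
  apply: (@norm_le_cvg0_eq0 _ _ (fun n => 2 * rnorm v * Num.sqrt (4 * n.+1%:R^-1))).
    by move=> n; exact: F_deriv.
  by rewrite -[0](mulr0 (2 * rnorm v)); apply: cvgMl_tmp.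
move=> x; apply/eqP; rewrite -subr_eq0 -normr_eq0 -sqrf_eq0; apply/eqP.
(* The real identity [Fz] is upgraded to a scalar one: tested at [conj_scalar w *: x], it says that
   the squared modulus of the defect [w] is zero. *)
set w := l x - _; have := Fz (conj_scalar w *: x).
rewrite /rdot linearZl_LR linearZ /= => /eqP; rewrite eq_sym -subr_eq0 -raddfB /=.
rewrite -mulrBr -/w mulrC mul_conj_scalar => /eqP w0.
by rewrite -[LHS]re_ge0K ?exprn_ge0 // w0 rmorph0.
Qed.

End Riesz.

(** * Existence of adjoints of bounded operators *)

Section Adjoint.
Set Implicit Arguments.
Unset Strict Implicit.
Variables (R : realType) (k : scalar_kind).
Local Notation K := (scalars R k).

(** For fixed [v], the functional [u |-> dot (A u) v] has bound [C * rnorm v], and its Riesz vector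
    serves as the value at [v]. Hence [xget] does not fall back on the zero map. *)
Lemma adjointP (U : hilbertType R k) (V : innerProductType R k) (A : {linear U -> V}) :
  bounded_op A -> forall u v, dot (A u) v = dot u (adjoint A v).
Proof.
move=> [C AC]; apply: (@xgetPex _ (cst 0) [set B : V -> U | forall u v, dot (A u) v = dot u (B v)]).
suff /choice[B AB] v : exists z, forall u, dot (A u) v = dot u z.
  by exists B => u v.
pose l u : K := dot (A u) v.
have lin : linear l by move=> a x y; rewrite /l !linearP linearDl linearZl_LR.
pose L : {linear U -> K} := HB.pack l (GRing.isLinear.Build _ _ _ _ l lin).
apply: (@riesz _ _ U L (C * rnorm v)) => x.
by rewrite (le_trans (norm_dot_le _ _)) // mulrAC ler_wpM2r ?rnorm_ge0.
Qed.

End Adjoint.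

(** * Norm and coordinates in the sequence space *)

Section Ell2Norm.
Set Implicit Arguments.
Unset Strict Implicit.
Variables (R : realType) (k : scalar_kind).
Local Notation K := (scalars R k).
Implicit Types c d : ell2 R k.

Lemma ell2_dot_cvg c d : series (fun n => c n * conj_scalar (d n)) @ \oo --> dot c d.
Proof. exact: is_cvg_ell2_dot. Qed.

Lemma ell2_norm_cvg c :
  series (fun n => re_scalar `|c n| ^+ 2) @ \oo --> rnorm c ^+ 2.
Proof.
have cu : cvgn (series (fun n => re_scalar `|c n| ^+ 2)).
  by apply: nneseries_lt_pinfty_cvg => [n|]; [exact: sqr_ge0|exact: ell2P c].
suff -> : rnorm c ^+ 2 = limn (series (fun n => re_scalar `|c n| ^+ 2)) by [].
apply: (@of_real_inj R k); rewrite rmorphXn /= rnormK -dotxx.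
apply: seq_cvg_unique (@ell2_dot_cvg c c) _ => //.
rewrite (_ : series _ = (fun n => of_real (series (fun n => re_scalar `|c n| ^+ 2) n))).
  exact: of_real_cvg.
apply/funext => n; rewrite rmorph_sum; apply: eq_bigr => i _.
by rewrite rmorphXn /= re_ge0K // mul_conj_scalar.
Qed.

Lemma ell2_series_le c n :
  series (fun n => re_scalar `|c n| ^+ 2) n <= rnorm c ^+ 2.
Proof.
have cc := @ell2_norm_cvg c; rewrite -(norm_cvg_lim (V := R) cc).
apply: nondecreasing_cvgn_le; last exact: cvgP cc.
by apply: nondecreasing_series => i _ _; exact: sqr_ge0.
Qed.

Lemma ell2_norm_series c :
  (\sum_(0 <= n <oo) (re_scalar `|c n| ^+ 2)%:E)%E = (rnorm c ^+ 2)%:E.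
Proof.
apply/cvg_lim => //; under eq_fun do rewrite sumEFin.
apply: cvg_EFin; [exact: nearW|exact: ell2_norm_cvg].
Qed.

Lemma dot_delta c n : dot c (delta n) = c n.
Proof.
apply: seq_cvg_unique (@ell2_dot_cvg c (delta n)) _ => //.
(* The partial sum of rank [m] runs over indices below [m], so it is stationary from rank [n.+1]
   on. *)
apply: cvg_near_cst; exists n.+1 => // m /= nm.
rewrite /series /= big_mkord (bigD1 (Ordinal nm)) //= eqxx rmorph1 mulr1.
rewrite big1 ?addr0 // => i; rewrite -val_eqE /= => /negbTE ->.
by rewrite rmorph0 mulr0.
Qed.

End Ell2Norm.

(** * Analysis and synthesis operators of a Bessel sequence *)

Section Bessel.
Set Implicit Arguments.
Unset Strict Implicit.
Variables (R : realType) (k : scalar_kind) (H : hilbertType R k).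
Local Notation K := (scalars R k).
Variables (Phi : nat -> H) (M : R).
Hypothesis bPhi : bessel_bound Phi M.
Implicit Types (c d : ell2 R k) (f g : H).

Lemma analysisE f n : analysis Phi f n = dot f (Phi n).
Proof.
rewrite /analysis; have [_ /(_ f) fM] := bPhi.
(* The Bessel bound makes the coefficients square-summable, so [insubd] does not return its
   default. *)
rewrite -[LHS]/(\val (insubd _ _) n) insubdK // unfold_in.
by apply: le_lt_trans fM _; exact: ltry.
Qed.

Lemma coef_sumE f : Defs.coef_sum Phi f = (rnorm (analysis Phi f) ^+ 2)%:E.
Proof. by rewrite -ell2_norm_series; apply: eq_eseriesr => n _; rewrite analysisE. Qed.

Lemma analysis_le f : rnorm (analysis Phi f) ^+ 2 <= M * rnorm f ^+ 2.
Proof. by rewrite -lee_fin -coef_sumE; exact: bPhi.2. Qed.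

Lemma analysis_linear : linear (analysis Phi).
Proof.
move=> a f g; apply: val_inj; apply/funext => n.
rewrite -[LHS]/(analysis Phi _ n) -[RHS]/(a * analysis Phi f n + analysis Phi g n).
by rewrite !analysisE linearDl linearZl_LR.
Qed.

Lemma analysis_sum_le f m n :
  \sum_(m <= i < n) re_scalar `|dot f (Phi i)| ^+ 2 <= M * rnorm f ^+ 2.
Proof.
apply: le_trans (analysis_le f).
have [mn|nm] := leqP m n; last by rewrite big_geq ?sqr_ge0 // ltnW.
apply: (@le_trans _ _ (series (fun i => re_scalar `|analysis Phi f i| ^+ 2) n)).
  under eq_bigr do rewrite -analysisE.
  rewrite /series /= [leRHS](big_cat_nat (n := m)) //=.
  by rewrite lerDr sumr_ge0 // => i _; rewrite sqr_ge0.
exact: ell2_series_le.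
Qed.

(** With [x] the finite sum, [rnorm x ^+ 2] pairs the [c i] with the coefficients of [x] itself. The
    Bessel inequality at [x] bounds the latter, and half of [rnorm x ^+ 2] is absorbed into the left
    side. *)
Lemma synthesis_sum_le c m n :
  rnorm (\sum_(m <= i < n) c i *: Phi i) ^+ 2 <=
  M * \sum_(m <= i < n) re_scalar `|c i| ^+ 2.
Proof.
have [M0 _] := bPhi; set x := \sum_(m <= i < n) _.
have := analysis_sum_le x m n.
rewrite -!rdotxx {2}/x.
have -> : rdot x (\sum_(m <= i < n) c i *: Phi i) =
    \sum_(m <= i < n) re_scalar (conj_scalar (c i) * dot x (Phi i)).
  rewrite /rdot !raddf_sum /=; apply: eq_bigr => i _.
  by rewrite linearZr_LR.
(* AM-GM with weight [M] on each term of [dot x x]. *)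
have : \sum_(m <= i < n) re_scalar (conj_scalar (c i) * dot x (Phi i)) <=
  \sum_(m <= i < n) (M * re_scalar `|c i| ^+ 2 + M^-1 * re_scalar `|dot x (Phi i)| ^+ 2) / 2.
  apply: ler_sum => i _; rewrite (le_trans (re_le_norm _)) // re_normM norm_conj_scalar.
  set a := re_scalar _; set b := re_scalar _.
  rewrite -subr_ge0.
  rewrite (_ : _ - _ = (M * a - b) ^+ 2 / (M * 2)).
    by rewrite divr_ge0 ?sqr_ge0 // mulr_ge0 // ltW.
  by field; rewrite gt_eqF.
rewrite -mulr_suml big_split /= -!mulr_sumr.
set X := \sum_(_ <= i < _) _; set Y := \sum_(_ <= i < _) _; set Z := \sum_(_ <= i < _) _.
by move=> XYZ ZX; have : M^-1 * Z <= X; [rewrite ler_pdivrMl|lra].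
Qed.

(** Blocks of the series are controlled by tails of the norm series of [c], so the partial sums are
    Cauchy and the [limn] in [synthesis] is a genuine limit. *)
Lemma synthesis_cvg c : series (fun n => c n *: Phi n) @ \oo --> synthesis Phi c.
Proof.
have [M0 _] := bPhi.
have cc := ell2_norm_cvg (c := c).
set u := series _ in cc.
apply: (@rnorm_cauchy_cvg _ _ _ _ (fun n => Num.sqrt (M * (rnorm c ^+ 2 - u n)))).
  move=> n m nm; rewrite -[leLHS]ger0_norm ?rnorm_ge0 // -sqrtr_sqr ler_wsqrtr //.
  rewrite sub_series_geq // (le_trans (synthesis_sum_le _ _ _)) // ler_pM2l //.
  rewrite lerBrDr -[leLHS](_ : u m = _); last first.
    by rewrite -(sub_series_geq _ nm) subrK.
  exact: ell2_series_le.
rewrite -[0 in X in _ --> X]sqrtr0 -(mulr0 M).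
apply: cvg_comp; last exact: sqrt_continuous.
by apply: cvgMl_tmp; rewrite -(subrr (rnorm c ^+ 2)); apply: cvgB => //; exact: cvg_cst.
Qed.

Lemma synthesis_linear : linear (synthesis Phi).
Proof.
move=> a c d; apply: seq_cvg_unique (@synthesis_cvg (a *: c + d)) _ => //.
rewrite (_ : series _ = (fun n => a *: series (fun n => c n *: Phi n) n) \+
    series (fun n => d n *: Phi n)).
  by apply: cvgD (cvgZl_tmp _) _; exact: synthesis_cvg.
apply/funext => n; rewrite /series /= scaler_sumr -big_split /=.
by apply: eq_bigr => i _; rewrite scalerA -scalerDl.
Qed.

Lemma dot_synthesis c f : dot (synthesis Phi c) f = dot c (analysis Phi f).
Proof.
apply: seq_cvg_unique (dot_cvgl (synthesis_cvg (c := c))) _ => //.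
rewrite (_ : (fun n => dot _ _) = series (fun n => c n * conj_scalar (analysis Phi f n))).
  exact: ell2_dot_cvg.
apply/funext => n; rewrite /series /= linear_sumlz; apply: eq_bigr => i _.
by rewrite linearZl_LR analysisE -dotC.
Qed.

End Bessel.

(** * Neumann iteration and the square root of [Id - A] for a contraction [A] *)

Section SquareRoot.
Set Implicit Arguments.
Unset Strict Implicit.
Variables (R : realType) (k : scalar_kind) (H : hilbertType R k).
Local Notation K := (scalars R k).
Variables (A : {linear H -> H}) (q : R).
Hypotheses (q01 : 0 <= q < 1) (Aq : forall x, rnorm (A x) <= q * rnorm x).

Let q0 : 0 <= q. Proof. by case/andP : q01. Qed.
Let q1 : q < 1. Proof. by case/andP : q01. Qed.

(** A difference of two points with equal image is fixed by [A], hence zero since [q < 1]. A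
    preimage of [y] is the limit of iterating [x |-> A x + y]. *)
Lemma neumann_bijective : bijective (fun x => x - A x).
Proof.
have inj : injective (fun x => x - A x).
  move=> x y /= E; have {}E : x = y - A y + A x by rewrite -E subrK.
  have xy : x - y = A (x - y).
    by rewrite linearB {1}E -!addrA addrC -!addrA addNr addr0 addrC.
  apply/eqP; rewrite -subr_eq0; apply/eqP/rnorm_eq0.
  have := Aq (x - y); rewrite -xy; have := rnorm_ge0 (x - y); have := q1; nra.
suff /choice[g gK] y : exists x, x - A x = y.
  by exists g => // x; exact/inj.
pose u n := iter n (fun x => A x + y) 0.
have uq n : rnorm (u n.+1 - u n) <= rnorm y * q ^+ n.
  elim: n => [|n IH]; first by rewrite /u /= linear0 add0r subr0 mulr1.
  rewrite /u iterS [X in _ - X]iterS -/(u n.+1) -/(u n) opprD addrACA subrr addr0.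
  rewrite -linearB (le_trans (Aq _)) // exprS mulrCA ler_wpM2l //.
have [x ux _] := geometric_cvg q01 uq; exists x.
have bA : bounded_op A by exists q.
have : (fun n => u n.+1) @ \oo --> A x + y.
  by apply: cvgD (bounded_cvg bA ux) _; exact: cvg_cst.
rewrite cvg_shiftS => /seq_cvg_unique /(_ ux) E.
by rewrite -{1}E addrAC subrr add0r.
Qed.

Hypothesis Asym : forall x y, dot (A x) y = dot x (A y).

Fixpoint sqrt_iter (n : nat) : H -> H :=
  if n is m.+1 then fun x => (of_real 2^-1 : K) *: (A x + sqrt_iter m (sqrt_iter m x))
  else cst 0.

Let Y := sqrt_iter.

Let Y_linear n : linear (Y n).
Proof.
elim: n => [|n IH] a x y /=; first by rewrite /cst scaler0 addr0.
rewrite -/(Y n) !IH linearP !scalerDr !scalerA (mulrC a) -!addrA; congr (_ + _).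
by rewrite addrCA.
Qed.

(** The bound [q] survives the recursion because [(q + q ^+ 2) / 2 <= q]. *)
Let Y_le n x : rnorm (Y n x) <= q * rnorm x.
Proof.
elim: n x => [|n IH] x /=; first by rewrite /cst rnorm0 mulr_ge0 ?rnorm_ge0.
rewrite -/(Y n) rnormZr ger0_norm //.
have := rnormD (A x) (Y n (Y n x)); have := Aq x; have := IH x; have := IH (Y n x).
have := rnorm_ge0 x; have := rnorm_ge0 (Y n x); have := q0; have := q1.
move: (rnorm _) (rnorm _) (rnorm _) (rnorm _) (rnorm _) => a b c d e.
nra.
Qed.

Let Y_sym n x y : dot (Y n x) y = dot x (Y n y).
Proof.
elim: n x y => [|n IH] x y /=; first by rewrite linear0l linear0r.
rewrite -/(Y n) linearZl_LR linearZr_LR /= conj_of_real.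
by rewrite (linearDl dot) /= (linearDr dot) /= Asym !IH.
Qed.

Let YB n x y : Y n (x - y) = Y n x - Y n y.
Proof. by rewrite -[x - y]addrC -scaleN1r Y_linear scaleN1r addrC. Qed.

Let YS n x : Y n.+1 x = (of_real 2^-1 : K) *: (A x + Y n (Y n x)).
Proof. by []. Qed.

(** A difference of squares splits through [Y n.+1 (Y n x)]. Each half gains a factor [q] from
    [Y_le], and the factor 1/2 of the recursion compensates for having two halves. *)
Let Y_step n x : rnorm (Y n.+1 x - Y n x) <= rnorm x * q ^+ n.
Proof.
elim: n x => [|n IH] x.
  rewrite /= /cst addr0 subr0 mulr1 rnormZr ger0_norm //.
  have := Aq x; have := rnorm_ge0 x; have := rnorm_ge0 (A x); have := q1; nra.
rewrite (YS n.+1) [X in _ - X]YS -scalerBr rnormZr ger0_norm //.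
rewrite opprD addrACA subrr add0r.
rewrite ler_pdivrMl // (le_trans (rnorm_distD (Y n.+1 (Y n x)) _ _)) // -YB.
rewrite mulr_natl mulr2n lerD //.
  by rewrite (le_trans (Y_le _ _)) // exprS mulrCA ler_wpM2l.
by rewrite (le_trans (IH _)) // exprS mulrA (mulrC _ q) ler_wpM2r ?exprn_ge0.
Qed.

Lemma sqrt_id_sub : exists Z : {linear H -> H},
  [/\ forall x y, dot (Z x) y = dot x (Z y), forall x, rnorm (Z x) <= q * rnorm x &
      forall x, Z (Z x) = 2%:R *: Z x - A x].
Proof.
have /choice[Z ZP] x : exists z, Y^~ x @ \oo --> z /\
    forall n, rnorm (Y n x - z) <= rnorm x / (1 - q) * q ^+ n.
  by have [z] := geometric_cvg q01 (Y_step^~ x); exists z.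
have YZ x := (ZP x).1.
have linZ : linear Z.
  move=> a x y; apply: seq_cvg_unique (YZ _) _.
  under eq_fun do rewrite Y_linear.
  by apply: cvgD (YZ y); exact: cvgZl_tmp.
pose L : {linear H -> H} := HB.pack Z (GRing.isLinear.Build _ _ _ _ Z linZ).
exists L; split => [x y|x|x] /=.
- apply: (seq_cvg_unique (V := K) (dot_cvgl (YZ x))).
  under eq_fun do rewrite Y_sym.
  exact: dot_cvgr.
- by apply: (rnorm_cvg_le (YZ x)) => n.
(* The diagonal limit passes through [Y n (Z x)]: [Y_le] handles the inner error, and the explicit
   rate in [ZP], at [x] and at [Z x], makes both errors geometric. *)
- have YY : (fun n => Y n (Y n x)) @ \oo --> Z (Z x).
    apply: (rnorm_squeeze (r := fun n => (rnorm (Z x) + q * rnorm x) / (1 - q) * q ^+ n)).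
      move=> n; rewrite (le_trans (rnorm_distD (Y n (Z x)) _ _)) // -YB.
      rewrite mulrDl mulrDl addrC lerD // ?(ZP _).2 //.
      by rewrite (le_trans (Y_le _ _)) // -!mulrA ler_wpM2l // !mulrA (ZP _).2.
    by apply: cvg_geometric; rewrite ger0_norm.
  have : (fun n => Y n.+1 x) @ \oo --> (of_real 2^-1 : K) *: (A x + Z (Z x)).
    by apply: cvgZl_tmp; apply: cvgD => //; exact: cvg_cst.
  rewrite (cvg_shiftS (Y^~ x)) => /seq_cvg_unique /(_ (YZ x)) E.
  rewrite -[in RHS]E scalerA -(rmorph_nat (@of_real R k)) -rmorphM divff // rmorph1 scale1r.
  by rewrite addrC addKr.
Qed.

End SquareRoot.

(** * Inverse and square root of a coercive symmetric operator *)

Section Coercive.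
Set Implicit Arguments.
Unset Strict Implicit.
Variables (R : realType) (k : scalar_kind) (H : hilbertType R k).
Local Notation K := (scalars R k).

Lemma conj_fixed (x : K) : conj_scalar x = x -> of_real (re_scalar x) = x.
Proof.
move=> xc; have := add_conj_scalar x; rewrite xc -mulr2n rmorphMn /=.
by move=> /eqP; rewrite eqrMn2r //= => /eqP.
Qed.

Variables (S : {linear H -> H}) (m C : R).
Hypotheses (m0 : 0 < m) (mC : m <= C).
Hypothesis S_le : forall x, rnorm (S x) <= C * rnorm x.
Hypothesis S_sym : forall x y, dot (S x) y = dot x (S y).
Hypothesis S_ge : forall x, m * rnorm x ^+ 2 <= rdot (S x) x.

Let t := m / C ^+ 2.
(** The square of [q] is the minimum over [t] of [1 - 2 * t * m + t ^+ 2 * C ^+ 2]; the assumption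
    [m <= C] keeps the radicand nonnegative. *)
Let q := Num.sqrt (1 - (m / C) ^+ 2).
Let C0 : 0 < C. Proof. exact: lt_le_trans mC. Qed.
Let t0 : 0 < t. Proof. by rewrite divr_gt0 // exprn_gt0. Qed.

Let mC01 : 0 < m / C <= 1.
Proof. by rewrite divr_gt0 // ler_pdivrMr ?mul1r. Qed.

Let q01 : 0 <= q < 1.
Proof.
case/andP : mC01 => a0 a1; rewrite sqrtr_ge0 -[ltRHS]sqrtr1 ltr_sqrt //.
by rewrite gtrBl exprn_gt0.
Qed.

Let tS := (of_real t : K) \*: S.
Let A : {linear H -> H} := idfun \- tS.

Let A_E x : A x = x - (of_real t : K) *: S x. Proof. by []. Qed.

(* The identity [|x - t S x|^2 = |x|^2 - 2 t <S x, x> + t^2 |S x|^2] is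
   optimized by [t = m / C^2]. *)
Let A_le x : rnorm (A x) <= q * rnorm x.
Proof.
case/andP : mC01 => a0 a1.
rewrite -(@ler_pXn2r _ 2) ?nnegrE ?mulr_ge0 ?rnorm_ge0 ?sqrtr_ge0 //.
rewrite exprMn sqr_sqrtr; last by rewrite subr_ge0 expr_le1 // ltW.
rewrite A_E rnormB_sqr rdotZr rnormZr exprMn real_normK ?num_real // rdotC.
have Sx2 : rnorm (S x) ^+ 2 <= C ^+ 2 * rnorm x ^+ 2.
  by rewrite -exprMn ler_pXn2r ?nnegrE ?mulr_ge0 ?rnorm_ge0 ?(ltW C0) ?S_le.
have h1 : t * (m * rnorm x ^+ 2) <= t * rdot (S x) x by rewrite ler_wpM2l // (ltW t0).
have h2 : t ^+ 2 * rnorm (S x) ^+ 2 <= t ^+ 2 * (C ^+ 2 * rnorm x ^+ 2).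
  by rewrite ler_wpM2l ?sqr_ge0.
have h3 : t * m = (m / C) ^+ 2 by rewrite /t; field; rewrite gt_eqF.
have h4 : t ^+ 2 * C ^+ 2 = (m / C) ^+ 2 by rewrite /t; field; rewrite gt_eqF.
rewrite mulrA h3 in h1; rewrite [leRHS]mulrA h4 in h2.
lra.
Qed.

(** Since [x - A x] is [t] times [S x], the Neumann inverse of [Id - A], precomposed with
    multiplication by [t], inverts [S]. *)
Lemma coercive_bijective : bijective S.
Proof.
have [g gl gr] := neumann_bijective q01 A_le.
have E x : x - A x = (of_real t : K) *: S x by rewrite A_E subKr.
have tU : (of_real t : K) != 0.
  by rewrite -(rmorph0 (@of_real R k)) (inj_eq (@of_real_inj R k)) gt_eqF.
exists (fun y => g ((of_real t : K) *: y)) => [x|y]; first by rewrite -E gl.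
by apply: (scalerI tU); rewrite -E gr.
Qed.

Let A_sym x y : dot (A x) y = dot x (A y).
Proof.
rewrite !A_E (linearBl dot) (linearBr dot) /= linearZl_LR linearZr_LR /=.
by rewrite conj_of_real S_sym.
Qed.

Lemma coercive_sqrt : exists B : H -> H,
  [/\ linear B, bounded_op B, positive_op B & B \o B = S].
Proof.
have [Z [Z_sym Z_le ZZ]] := sqrt_id_sub q01 A_le A_sym.
(* As [Id - Z] squares to [t] times [S], the scaling must satisfy [c ^+ 2 * t = 1]. *)
pose c : R := Num.sqrt t^-1.
have c0 : 0 <= c by exact: sqrtr_ge0.
pose B x := (of_real c : K) *: (x - Z x).
have B_sym u v : dot (B u) v = dot u (B v).
  rewrite /B linearZl_LR linearZr_LR /= (linearBl dot) (linearBr dot) /=.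
  by rewrite conj_of_real Z_sym.
exists B; split.
- move=> a x y; rewrite /B linearP scalerA mulrC -scalerA -scalerDr.
  by rewrite opprD addrACA scalerBr.
- exists (c * (1 + q)) => x; rewrite rnormZr ger0_norm // -mulrA ler_wpM2l //.
  by rewrite (le_trans (rnormD _ _)) // rnormN mulrDl mul1r lerD2l Z_le.
(* Symmetry makes the quadratic form real; its real part is nonnegative because [Z] has norm bound
   [q < 1]. *)
- split=> // u; rewrite -[dot _ _]conj_fixed; last by rewrite -dotC B_sym.
  rewrite -(rmorph0 (@of_real R k)) ler_of_real -/(rdot _ _) /B rdotZl.
  rewrite mulr_ge0 // rdotBl rdotxx subr_ge0 (le_trans (ler_norm _)) //.
  rewrite (le_trans (rdot_le _ _)) // expr2 ler_wpM2r ?rnorm_ge0 //.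
  by rewrite (le_trans (Z_le _)) // ler_piMl ?rnorm_ge0 //; case/andP : q01 => _ /ltW.
- apply/funext => x /=; have E : x - Z x - Z (x - Z x) = (of_real t : K) *: S x.
    rewrite (linearB Z) ZZ A_E scaler_nat mulr2n.
    set y := _ *: S x; have -> : Z x - (Z x + Z x - (x - y)) = x - Z x - y.
      by rewrite opprB opprD addrCA addNKr addrAC.
    by rewrite subKr.
  rewrite /B [Z (_ *: _)]linearZ_LR -scalerBr E !scalerA -!rmorphM -mulrA mulrA -expr2.
  by rewrite sqr_sqrtr ?invr_ge0 ?(ltW t0) // mulVf ?rmorph1 ?scale1r // gt_eqF.
Qed.

End Coercive.

(** * The frame operator, its square root and the inverse of that root *)

Section FrameOperator.
Set Implicit Arguments.
Unset Strict Implicit.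
Variables (R : realType) (k : scalar_kind) (H : hilbertType R k).
Local Notation K := (scalars R k).
Variables (Phi : nat -> H) (M : R).
Hypotheses (framePhi : frame Phi) (besselPhi : bessel_bound Phi M).

Local Notation S := (frame_op Phi).
Local Notation B := (frame_sqrt Phi).
Local Notation Bi := (frame_inv_sqrt Phi).

Let S_linear : linear S.
Proof.
by move=> a x y; rewrite /frame_op /= (analysis_linear besselPhi) (synthesis_linear besselPhi).
Qed.

Lemma dot_frame_op x y : dot (S x) y = dot (analysis Phi x) (analysis Phi y).
Proof. exact: dot_synthesis besselPhi _ _. Qed.

Let S_sym x y : dot (S x) y = dot x (S y).
Proof. by rewrite dot_frame_op [RHS]dotC dot_frame_op -dotC. Qed.

Lemma rdot_frame_op x : rdot (S x) x = rnorm (analysis Phi x) ^+ 2.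
Proof. by rewrite -rdotxx /rdot dot_frame_op. Qed.

(** The square of [rnorm (S x)] is the pairing of the analyses of [x] and [S x]; two uses of the
    Bessel bound give [M * rnorm x * rnorm (S x)], and one factor cancels. *)
Let S_le x : rnorm (S x) <= M * rnorm x.
Proof.
have [M0 _] := besselPhi.
have [S0|S0] := eqVneq (rnorm (S x)) 0; first by rewrite S0 mulr_ge0 ?rnorm_ge0 // ltW.
have Sp : 0 < rnorm (S x) by rewrite lt_def S0 rnorm_ge0.
rewrite -(@ler_pM2r _ (rnorm (S x))) // -expr2 -rdotxx.
rewrite /rdot dot_frame_op -/(rdot _ _) (le_trans (ler_norm _)) // (le_trans (rdot_le _ _)) //.
rewrite -(@ler_pXn2r _ 2) ?nnegrE ?mulr_ge0 ?rnorm_ge0 ?(ltW M0) //.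
rewrite exprMn.
apply: (@le_trans _ _ ((M * rnorm x ^+ 2) * (M * rnorm (S x) ^+ 2))).
  by rewrite ler_pM ?sqr_ge0 // (analysis_le besselPhi).
by rewrite le_eqVlt; apply/orP; left; apply/eqP; ring.
Qed.

Let S_pack : {linear H -> H} := HB.pack S (GRing.isLinear.Build _ _ _ _ S S_linear).

(** The upper constant is enlarged to [M + m] so that it dominates [m]: in the zero space a lower
    frame bound may exceed [M]. *)
Let S_coercive : exists m, [/\ 0 < m, forall x, rnorm (S x) <= (M + m) * rnorm x &
  forall x, m * rnorm x ^+ 2 <= rdot (S x) x].
Proof.
have [m [_ [[m0 mS] _]]] := framePhi; exists m; split => // x.
  by rewrite (le_trans (S_le x)) // ler_wpM2r ?rnorm_ge0 // lerDl ltW.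
by rewrite rdot_frame_op -lee_fin -(coef_sumE besselPhi).
Qed.

Let M_ge0 : 0 <= M. Proof. by case: besselPhi => /ltW. Qed.

(** Existence of one root suffices: [xget] then returns a map with these four properties. *)
Lemma frame_sqrtP : [/\ linear B, bounded_op B, positive_op B & B \o B = S].
Proof.
apply: (@xgetPex _ (cst 0) [set B : H -> H | [/\ linear B, bounded_op B, positive_op B & B \o B = S]]).
have [m [m0 Sm mS]] := S_coercive.
by apply: (@coercive_sqrt _ _ _ S_pack m (M + m)) => //; rewrite lerDr.
Qed.

Lemma frame_inv_sqrtP : cancel B Bi /\ cancel Bi B.
Proof.
apply: (@xgetPex _ (cst 0) [set B' : H -> H | cancel B B' /\ cancel B' B]).
have [m [m0 Sm mS]] := S_coercive.
have [h hS Sh] : bijective S.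
  by apply: (@coercive_bijective _ _ _ S_pack m (M + m)) => //; rewrite lerDr.
have [_ _ _ /funeqP BB] := frame_sqrtP.
have hB x : h (B (B x)) = x by rewrite -[B (B x)]/((B \o B) x) BB hS.
have Bh x : B (B (h x)) = x by rewrite -[B (B _)]/((B \o B) _) BB Sh.
(* [h] composed with [B] is a left inverse because [h] inverts [B \o B]; for the right inverse, [y]
   is first written as [B (B (h y))]. *)
exists (h \o B); split => y /=; first exact: hB.
by rewrite -{1}[y]Bh hB Bh.
Qed.

(** Both squares equal [rdot (S x) x], by symmetry of [B] and by adjointness of synthesis and
    analysis. *)
Lemma rnorm_frame_sqrt x : rnorm (B x) = rnorm (analysis Phi x).
Proof.
have [_ _ [Bsym _] /funeqP BB] := frame_sqrtP.
apply/eqP; rewrite -(@eqrXn2 _ 2) ?rnorm_ge0 // -rdot_frame_op -rdotxx.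
by rewrite /rdot -Bsym -BB.
Qed.

Lemma frame_sqrt_le x : rnorm (B x) <= Num.sqrt M * rnorm x.
Proof.
rewrite -(@ler_pXn2r _ 2) ?nnegrE ?mulr_ge0 ?rnorm_ge0 ?sqrtr_ge0 //.
by rewrite exprMn sqr_sqrtr // rnorm_frame_sqrt (analysis_le besselPhi).
Qed.

Lemma dot_frame_inv_sqrt x y : dot (Bi x) y = dot x (Bi y).
Proof.
have [_ _ [Bsym _] _] := frame_sqrtP; have [_ BBi] := frame_inv_sqrtP.
by rewrite -{1}[y]BBi -Bsym BBi.
Qed.

End FrameOperator.

(** * The approximate dual: its coefficients, Bessel bound and norm estimate *)

Lemma opnorm_ge (R : realType) (k : scalar_kind) (U V : normedModType (scalars R k))
    (A : U -> V) (x : U) : rnorm x <= 1 -> ((rnorm (A x))%:E <= opnorm A)%E.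
Proof. by move=> x1; apply: ereal_sup_ubound; exists x. Qed.

Section ApproximateDual.
Set Implicit Arguments.
Unset Strict Implicit.
Variables (R : realType) (k : scalar_kind) (H : hilbertType R k).
Local Notation K := (scalars R k).
Variables (Phi : nat -> H) (M : R).
Hypotheses (framePhi : frame Phi) (besselPhi : bessel_bound Phi M).
Variables (D : {linear H -> H}) (Theta : {linear H -> ell2 R k}).
Hypotheses (boundedD : bounded_op D) (boundedTheta : bounded_op Theta).

Local Notation Psi :=
  (fun n => adjoint D (frame_inv_sqrt Phi (Phi n)) + adjoint Theta (delta n)).
Local Notation coef f := (analysis Phi (frame_inv_sqrt Phi (D f)) + Theta f).

Let dot_Psi f n : dot f (Psi n) = coef f n.
Proof.
rewrite linearDr /= -!adjointP // dot_delta -(dot_frame_inv_sqrt framePhi besselPhi).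
by rewrite -(analysisE besselPhi).
Qed.

Lemma approximate_dual_bessel : bessel Psi.
Proof.
have [CD DC] := boundedD; have [CT TC] := boundedTheta.
(* The summand 1 ensures that the bound is positive even if [CD + CT] is zero. *)
exists ((CD + CT) ^+ 2 + 1); split; first by rewrite ltr_wpDl ?sqr_ge0.
move=> f; rewrite /Defs.coef_sum; under eq_eseriesr do rewrite dot_Psi.
rewrite ell2_norm_series lee_fin mulrDl mul1r -exprMn ler_wpDr ?sqr_ge0 //.
have le_coef : rnorm (coef f) <= (CD + CT) * rnorm f.
  (* The analysis of [Bi (D f)] has the norm of [B (Bi (D f))], which is [D f]. *)
  rewrite (le_trans (rnormD _ _)) // mulrDl lerD // -(rnorm_frame_sqrt framePhi besselPhi).
  by rewrite (frame_inv_sqrtP framePhi besselPhi).2.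
by rewrite ler_pXn2r ?nnegrE ?rnorm_ge0 // (le_trans _ le_coef) ?rnorm_ge0.
Qed.

Lemma analysis_approximate_dual f : analysis Psi f = coef f.
Proof.
(* A Bessel bound for [Psi] is what guarantees that [analysis Psi f] is not the default zero
   sequence. *)
have [M' besselPsi] := approximate_dual_bessel.
apply: val_inj; apply/funext => n.
by rewrite -[LHS]/(analysis Psi f n) (analysisE besselPsi) dot_Psi.
Qed.

Lemma synthesis_approximate_dual : (forall f, synthesis Phi (Theta f) = 0) ->
  synthesis Phi \o analysis Psi = frame_sqrt Phi \o D.
Proof.
move=> T0; apply/funext => f /=; rewrite analysis_approximate_dual.
rewrite -[analysis _ _]scale1r (synthesis_linear besselPhi) scale1r T0 addr0.
have [_ _ _ /funeqP BB] := frame_sqrtP framePhi besselPhi.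
by rewrite -[LHS]BB /= (frame_inv_sqrtP framePhi besselPhi).2.
Qed.

Lemma opnorm_frame_sqrt_comp :
  (opnorm (frame_inv_sqrt Phi \- D)%R < (1 / Num.sqrt M)%:E)%E ->
  (opnorm (idfun \- (frame_sqrt Phi \o D))%R < 1)%E.
Proof.
have [M0 _] := besselPhi; set N := opnorm _ => NM.
have sM : 0 < Num.sqrt M by rewrite sqrtr_gt0.
(* Evaluating at 0 shows [N] nonnegative; being also below a real number, it is finite and [fine N]
   is faithful. *)
have N0 : (0 <= N)%E.
  apply: le_trans (@opnorm_ge _ _ _ _ _ 0 _); first by rewrite lee_fin rnorm_ge0.
  by rewrite rnorm0.
have Nfin : N \is a fin_num by rewrite ge0_fin_numE // (lt_trans NM) ?ltry.
apply: (@le_lt_trans _ _ (Num.sqrt M * fine N)%:E); last first.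
  by rewrite lte_fin mulrC -ltr_pdivlMr // -lte_fin fineK.
apply: ge_ereal_sup => _ [f f1 <-]; rewrite lee_fin /=.
have [linB _ _ _] := frame_sqrtP framePhi besselPhi.
have subB u v : frame_sqrt Phi (u - v) = frame_sqrt Phi u - frame_sqrt Phi v.
  by rewrite -(scaleN1r v) addrC linB scaleN1r addrC.
(* Writing [f] as [B (Bi f)] factors the difference as [B (Bi f - D f)], so [Num.sqrt M] and [N]
   multiply. *)
rewrite -{1}[f](frame_inv_sqrtP framePhi besselPhi).2 -subB.
rewrite (le_trans (frame_sqrt_le framePhi besselPhi _)) // ler_wpM2l ?sqrtr_ge0 //.
by rewrite -lee_fin fineK //; exact: opnorm_ge.
Qed.

End ApproximateDual.

Theorem theorem2p4 (R : realType) (k : scalar_kind) (H : hilbertType R k)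
    (sepH : separable H) (Phi : nat -> H) (M : R)
    (framePhi : frame Phi) (besselPhi : bessel_bound Phi M)
    (D : {linear H -> H}) (boundedD : bounded_op D)
    (normD : (opnorm (frame_inv_sqrt Phi \- D)%R < (1 / Num.sqrt M)%:E)%E)
    (Theta : {linear H -> ell2 R k}) (ranTheta : ran_synthesis Phi Theta) :
  let Phi_ad (n : nat) : H :=
    adjoint D (frame_inv_sqrt Phi (Phi n)) + adjoint Theta (delta n) in
  approximately_dual Phi Phi_ad /\
  synthesis Phi \o analysis Phi_ad = frame_sqrt Phi \o D.
Proof.
move=> Phi_ad; have [boundedTheta Theta0] := ranTheta.
have TU := synthesis_approximate_dual framePhi besselPhi boundedD boundedTheta Theta0.
split; last exact: TU.
split; first by exists M.
- exact (approximate_dual_bessel framePhi besselPhi boundedD boundedTheta).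
- by left; rewrite [X in idfun \- X]TU; exact (opnorm_frame_sqrt_comp framePhi besselPhi normD).
Qed.
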